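(* Let $\tau\in C_b(\mathbb{R})$. For each $f\in\mathcal{A}_\tau$ there is a sequence $(g_n)$ in the set $$\{\mu_{K,\epsilon_1}:\ 0<\epsilon_2<\epsilon_1<1,\ K\subseteq|\tau|^{-1}([0,\epsilon_2])\text{ compact}\}$$ such that $fg_n\to f$ in $\mathcal{A}_\tau$.
   Context: $\mathcal{A}=C_0(\mathbb{R})$ with the sup norm, and the Segal algebra corresponding to $\tau$ is $\mathcal{A}_\tau=\{f\in\mathcal{A}:\sum_{k=0}^\infty\|f\tau^k\|_\infty<\infty\}$, with norm $\|f\|_\tau=\sum_{k=0}^\infty\|f\tau^k\|_\infty$. $|\tau|^{-1}(E)$ is the preimage of $E$ under $|\tau|$. For each $0<\epsilon_2<\epsilon_1<1$ and each compact $K\subseteq|\tau|^{-1}([0,\epsilon_2])$, $\mu_{K,\epsilon_1}$ (in the paper $\mu_{K_{\epsilon_2}^{(\tau)},\epsilon_1}$) is a fixed continuous function $\mathbb{R}\to[0,1]$ in $\mathcal{A}_\tau\cap C_c(\mathbb{R})$, chosen by Urysohn's lemma, such that $\mu_{K,\epsilon_1}=1$ on $K$ and ${\rm supp}\,\mu_{K,\epsilon_1}\subseteq|\tau|^{-1}([0,\epsilon_1])$. *)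

(* Defs.v *)
From mathcomp Require Import all_boot all_order all_algebra.
From mathcomp Require Import all_classical all_reals all_analysis.
From mathcomp Require Import complex.

Set Implicit Arguments.
Unset Strict Implicit.
Unset Printing Implicit Defensive.

Import Order.TTheory GRing.Theory Num.Theory numFieldNormedType.Exports.
Import Normc.

Local Open Scope classical_set_scope.
Local Open Scope ring_scope.

(* The topology and norm on the complex numbers are those of the regular
   algebra R[i]^o.  The functions R -> R[i]^o form a ring under the pointwise
   operations, so that f * tau ^+ k below is a pointwise product. *)

(* The norm `|z| of MathComp takes its values in R[i]; normc z is the same
   modulus as an element of R. *)
Definition modulus (R : realType) (f : R -> R[i]^o) : R -> R :=
  fun x => normc (f x).

Definition sup_norm (R : realType) (f : R -> R[i]^o) : \bar R :=
  ereal_sup (range (EFin \o modulus f)).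

Definition C_b (R : realType) : set (R -> R[i]^o) :=
  [set f | continuous f /\ bounded_fun f].

Definition C_0 (R : realType) : set (R -> R[i]^o) :=
  [set f | [/\ continuous f,
               f x @[x --> +oo] --> (0 : R[i]^o)
             & f x @[x --> -oo] --> (0 : R[i]^o)]].

Definition supp (R : realType) (f : R -> R[i]^o) : set R :=
  closure [set x | f x != 0].

Definition C_c (R : realType) : set (R -> R[i]^o) :=
  [set f | continuous f /\ compact (supp f)].

Definition segal_norm (R : realType) (tau f : R -> R[i]^o) : \bar R :=
  (\sum_(0 <= k <oo) sup_norm (f * tau ^+ k)%R)%E.

Definition segal (R : realType) (tau : R -> R[i]^o) : set (R -> R[i]^o) :=
  [set f | C_0 f /\ (segal_norm tau f < +oo)%E].

Definition segal_cvg (R : realType) (tau : R -> R[i]^o)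
    (h : nat -> R -> R[i]^o) (l : R -> R[i]^o) : Prop :=
  [/\ forall n, segal tau (h n),
      segal tau l
    & segal_norm tau (h n - l) @[n --> \oo] --> 0%E].

Definition toC (R : realType) (g : R -> R) : R -> R[i]^o :=
  fun x => real_complex R (g x).

(* |tau|^-1([0, e]) *)
Definition sublevel (R : realType) (tau : R -> R[i]^o) (e : R) : set R :=
  modulus tau @^-1` `[0, e].

Definition admissible (R : realType) (tau : R -> R[i]^o)
    (e2 e1 : R) (K : set R) : Prop :=
  [/\ 0 < e2, e2 < e1, e1 < 1, compact K & K `<=` sublevel tau e2].

Definition is_cutoff (R : realType) (tau : R -> R[i]^o)
    (K : set R) (e1 : R) (m : R -> R) : Prop :=
  [/\ continuous m /\ (forall x, 0 <= m x <= 1),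
      segal tau (toC m),
      C_c (toC m),
      (forall x, K x -> m x = 1)
    & supp (toC m) `<=` sublevel tau e1].

(* A family of fixed choices mu K e1; its values outside the admissible
   parameters are irrelevant. *)
Definition cutoff_family (R : realType) (tau : R -> R[i]^o)
    (mu : set R -> R -> R -> R) : Prop :=
  forall (e2 e1 : R) (K : set R),
    admissible tau e2 e1 K -> is_cutoff tau K e1 (mu K e1).

Definition cutoffs (R : realType) (tau : R -> R[i]^o)
    (mu : set R -> R -> R -> R) : set (R -> R) :=
  [set g | exists (e2 e1 : R) (K : set R),
    admissible tau e2 e1 K /\ g = mu K e1].

(* Main.v *)
(** An element [f] of the Segal algebra vanishes wherever [|tau| >= 1], since
    there the terms of its norm series do not tend to [0].  Hence the compact
    set [{|f| >= d}] lies in some sublevel set [{|tau| <= e2}] with [e2 < 1],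
    and for a cutoff [g] equal to [1] on it, [|(f g - f) tau^k|] is bounded
    both by [d], uniformly in [k], and by [|f tau^k|].  Letting [d] tend to
    [0], dominated convergence for series gives the claim. *)
Require Import Defs.
From mathcomp Require Import all_boot all_order all_algebra.
From mathcomp Require Import all_classical all_reals all_analysis.
From mathcomp Require Import complex.

Import Order.TTheory GRing.Theory Num.Theory numFieldNormedType.Exports.
Local Open Scope classical_set_scope.
Local Open Scope ring_scope.

Import Normc.

Lemma normc_ge0 (R : rcfType) (z : R[i]) : 0 <= normc z.
Proof. by case: z => a b; exact: sqrtr_ge0. Qed.

Lemma normc_real (R : rcfType) (x : R) : normc (real_complex R x) = `|x|.
Proof. by rewrite /normc /= expr0n addr0 sqrtr_sqr. Qed.

Lemma normc_dist (R : rcfType) (z w : R[i]) :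
  `|normc z - normc w| <= normc (z - w).
Proof.
rewrite -lecR -(normc_real _ (_ - _)) rmorphB.
exact: (ler_dist_dist z w).
Qed.

Lemma cvg_normc (R : realType) (T : Type) (F : set_system T) (FF : Filter F)
    (f : T -> R[i]^o) (l : R[i]^o) :
  f x @[x --> F] --> l -> normc (f x) @[x --> F] --> normc l.
Proof.
move=> /cvgrPdist_lt fl; apply/cvgrPdist_lt => e e0.
have eC0 : 0 < real_complex R e by rewrite ltcR.
have := fl _ eC0; apply: filterS => x.
rewrite ltcR; exact: le_lt_trans (normc_dist _ _ _).
Qed.

Lemma cvg0_normc (R : realType) (T : Type) (F : set_system T) (FF : Filter F)
    (f : T -> R[i]^o) :
  normc (f x) @[x --> F] --> (0 : R) -> f x @[x --> F] --> (0 : R[i]^o).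
Proof.
move=> /cvgr0Pnorm_lt f0; apply/cvgr0Pnorm_lt => e e0.
(* A positive element of [R[i]] is real, hence equal to its own modulus; this turns the complex [e]
   into a real bound. *)
have eE : e = real_complex R (normc e) by rewrite -[LHS]gtr0_norm.
have ne0 : 0 < normc e by rewrite -ltcR -eE.
have := f0 _ ne0; apply: filterS => x.
by rewrite ger0_norm ?normc_ge0// -ltcR -eE.
Qed.

Lemma nneseries_tail_lt (R : realType) (u : nat -> \bar R) (e : R) :
  (forall k, 0 <= u k)%E -> (\sum_(0 <= k <oo) u k < +oo)%E -> 0 < e ->
  exists N, (\sum_(N <= k <oo) u k < e%:E)%E.
Proof.
move=> u0 uoo e0.
have /fine_cvgP[ufin] : (\sum_(N <= k <oo) u k)%E @[N --> \oo] --> (0 : R)%:E.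
  exact: nneseries_tail_cvg.
move=> /cvgr0Pnorm_lt/(_ e e0) ue.
have [N [Nfin]] := filter_ex (filterI ufin ue).
rewrite /= => /(le_lt_trans (ler_norm _)).
by rewrite -lte_fin fineK// => Ne; exists N.
Qed.

Lemma cvge0P (R : realType) (u : nat -> \bar R) :
  (forall n, 0 <= u n)%E ->
  (forall e : R, 0 < e -> \forall n \near \oo, (u n <= e%:E)%E) ->
  u n @[n --> \oo] --> (0 : \bar R)%E.
Proof.
move=> u0 ue.
have fin e n : (u n <= e%:E)%E -> u n \is a fin_num.
  by move=> h; rewrite ge0_fin_numE// (le_lt_trans h)// ltry.
apply/fine_cvgP; split; first by apply: filterS (ue _ ltr01) => n; exact: fin.
apply/cvgr0Pnorm_le => e e0; have := ue _ e0; apply: filterS => n une.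
rewrite /= ger0_norm ?fine_ge0// -lee_fin fineK//; exact: fin une.
Qed.

(** Cut the series at an [N] where the tail of [v] is below [e / 2]. The tail of [u n] is then small
    for every [n], and the [N] remaining terms are each at most [d n], hence small together for
    large [n]. *)
Lemma nneseries_dominated_cvg0 (R : realType) (u : nat -> nat -> \bar R)
    (v : nat -> \bar R) (d : nat -> R) :
  (forall n k, 0 <= u n k)%E -> (forall n k, u n k <= v k)%E ->
  (\sum_(0 <= k <oo) v k < +oo)%E ->
  (forall n k, u n k <= (d n)%:E)%E -> d n @[n --> \oo] --> 0 ->
  (\sum_(0 <= k <oo) u n k)%E @[n --> \oo] --> (0 : \bar R)%E.
Proof.
move=> u0 uv voo ud d0.
have v0 k : (0 <= v k)%E := le_trans (u0 0%N k) (uv _ _).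
apply: cvge0P => [n|e e0]; first exact: nneseries_ge0.
have e20 : 0 < e / 2 by rewrite divr_gt0.
have [N Ne] := nneseries_tail_lt _ _ _ v0 voo e20.
(* Dividing by [N.+1] rather than [N] covers [N = 0]; the [N] head terms still add up to at most
   [e / 2]. *)
have eN0 : 0 < e / 2 / N.+1%:R by rewrite divr_gt0.
have /cvgr0Pnorm_lt/(_ _ eN0) := d0; apply: filterS => n dn.
rewrite (nneseries_split 0 N)// add0n [e]splitr EFinD leeD//.
- apply: (@le_trans _ _ (\sum_(0 <= k < N) (e / 2 / N.+1%:R)%:E)%E).
    apply: lee_sum => k _; apply: (le_trans (ud n k)); rewrite lee_fin.
    exact: le_trans (ler_norm _) (ltW dn).
  rewrite sumEFin lee_fin sumr_const_nat subn0 -[leLHS]mulr_natr -[leLHS]mulrA.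
  rewrite ler_piMr//; first exact: ltW.
  by rewrite mulrC ler_pdivrMr// mul1r ler_nat.
- by apply: le_trans (ltW Ne); exact: lee_nneseries.
Qed.

Section Modulus.
Context {R : realType}.
Implicit Types f g h tau : R -> R[i]^o.

Lemma modulus_ge0 f x : 0 <= modulus f x. Proof. exact: normc_ge0. Qed.

Lemma modulusM f g x : modulus (f * g) x = modulus f x * modulus g x.
Proof. exact: normcM. Qed.

Lemma modulusX f k x : modulus (f ^+ k) x = modulus f x ^+ k.
Proof.
elim: k => [|k IH]; last by rewrite !exprS modulusM IH.
by rewrite !expr0 /modulus; exact: normc1.
Qed.

Lemma continuous_modulus f : continuous f -> continuous (modulus f).
Proof. by move=> cf x; apply: cvg_normc; exact: cf. Qed.

Lemma sup_norm_ub f x : ((modulus f x)%:E <= sup_norm f)%E.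
Proof. by apply: ereal_sup_ubound; exists x. Qed.

Lemma sup_norm_le f (M : \bar R) :
  (forall x, (modulus f x)%:E <= M)%E -> (sup_norm f <= M)%E.
Proof. by move=> h; apply: ge_ereal_sup => _ [x _ <-]; exact: h. Qed.

Lemma sup_norm_ge0 f : (0 <= sup_norm f)%E.
Proof. by apply: le_trans (sup_norm_ub f 0); rewrite lee_fin modulus_ge0. Qed.

Lemma le_sup_normM f g h : (forall x, modulus f x <= modulus g x) ->
  (sup_norm (f * h)%R <= sup_norm (g * h)%R)%E.
Proof.
move=> fg; apply: sup_norm_le => x; apply: le_trans (sup_norm_ub _ x).
by rewrite lee_fin !modulusM ler_wpM2r ?modulus_ge0.
Qed.

Lemma segal_modulus0 tau f x :
  (segal_norm tau f < +oo)%E -> 1 <= modulus tau x -> modulus f x = 0.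
Proof.
move=> foo tx; apply: contrapT => /eqP fx0.
have fx : 0 < modulus f x by rewrite lt_def fx0 modulus_ge0.
have u0 k : (0 <= sup_norm (f * tau ^+ k)%R)%E by exact: sup_norm_ge0.
have [N] := nneseries_tail_lt _ _ _ u0 foo fx.
apply/negP; rewrite -leNgt.
(* The tail is bounded below by its first term alone, of index [N], whose value at [x] is
   [|f x| |tau x|^N >= |f x|]. *)
apply: le_trans (nneseries_lim_ge N.+1 (fun n _ _ => u0 n)).
rewrite big_nat1; apply: le_trans (sup_norm_ub _ x).
by rewrite lee_fin modulusM modulusX ler_peMr ?modulus_ge0// exprn_ege1.
Qed.

(** The set is closed by continuity of the modulus, and the limits at both infinities trap it in a
    segment [[m, M]]. *)
Lemma C_0_compact f (d : R) : C_0 f -> 0 < d ->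
  compact [set x | d <= modulus f x].
Proof.
move=> [cf fp fm] d0.
have near0 (F : set_system R) (FF : Filter F) :
    f x @[x --> F] --> (0 : R[i]^o) -> \forall x \near F, modulus f x < d.
  move=> /cvg_normc; rewrite normc0 => /cvgr0Pnorm_lt/(_ _ d0).
  by apply: filterS => x; rewrite ger0_norm ?normc_ge0.
have [M [_ fM]] := near0 _ _ fp; have [m [_ fm']] := near0 _ _ fm.
apply: (@subclosed_compact _ _ `[m, M]%classic).
- apply: (@closed_comp _ _ (modulus f) [set y | d <= y]); last exact: closed_ge.
  by move=> x _; exact: continuous_modulus.
- exact: segment_compact.
- move=> x /= dx; rewrite in_itv /=.
  apply/andP; split; rewrite leNgt; apply/negP.
    by move=> /fm'; rewrite ltNge dx.
  by move=> /fM; rewrite ltNge dx.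
Qed.

Lemma compact_sublevel tau (K : set R) : continuous tau -> compact K ->
  (forall x, K x -> modulus tau x < 1) ->
  exists e2 : R, [/\ 0 < e2, e2 < 1 & K `<=` sublevel tau e2].
Proof.
move=> ctau cK K1; have [K0|/set0P K0] := eqVneq K set0.
  by exists 2^-1; split; rewrite ?invr_gt0 ?invf_lt1 ?ltr1n// K0.
have [|c] := compact_EVT_max K0 cK (f := modulus tau).
  exact/continuous_subspaceT/continuous_modulus.
(* The maximum of [|tau|] on [K] is attained at [c], so it is below [1]. Taking the larger of it and
   [2^-1] keeps [e2] positive even if [tau] vanishes on [K]. *)
rewrite inE => /K1 c1 cmax; exists (Num.max 2^-1 (modulus tau c)); split.
- by rewrite lt_max invr_gt0 ltr0n.
- by rewrite gt_max c1 invf_lt1 ?ltr1n.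
- move=> x Kx; rewrite /sublevel /= in_itv /= modulus_ge0 /= le_max.
  by rewrite cmax ?orbT ?inE.
Qed.

(** Squeezing gives the limits at infinity and termwise comparison gives the finite norm. This
    places the products [f * toC (g n)] in the algebra. *)
Lemma segal_dominated tau f g : segal tau f -> continuous g ->
  (forall x, modulus g x <= modulus f x) -> segal tau g.
Proof.
move=> [[cf fp fm] foo] cg gf; split; last first.
  apply: le_lt_trans foo; apply: lee_nneseries => [k _ _|k _].
    exact: sup_norm_ge0.
  exact: le_sup_normM.
have g0 (F : set_system R) (FF : Filter F) :
    f x @[x --> F] --> (0 : R[i]^o) -> g x @[x --> F] --> (0 : R[i]^o).
  move=> /cvg_normc; rewrite normc0 => f0; apply: cvg0_normc.
  apply: (squeeze_cvgr _ (cvg_cst 0) f0); apply: nearW => x.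
  by rewrite normc_ge0; exact: gf.
by split=> //; exact: g0.
Qed.

Lemma modulusMtoC f (m : R -> R) x : 0 <= m x ->
  modulus (f * toC m) x = modulus f x * m x.
Proof. by move=> mx; rewrite modulusM /modulus /toC normc_real ger0_norm. Qed.

Lemma modulusMtoCB f (m : R -> R) x : m x <= 1 ->
  modulus (f * toC m - f) x = modulus f x * (1 - m x).
Proof.
move=> mx; have -> : f * toC m - f = f * toC (fun y => m y - 1).
  apply/funext => y; rewrite -[RHS]/(f y * real_complex R (m y - 1)).
  by rewrite rmorphB rmorph1 mulrBr mulr1.
rewrite modulusM; congr (_ * _).
by rewrite /modulus /toC normc_real distrC ger0_norm ?subr_ge0.
Qed.

(** Take [K] to be the set where [|f| >= d]. On [K] the factor [1 - m x] is zero; off [K] it lies in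
    [[0, 1]] and [|f x| < d]. *)
Lemma segal_cutoff tau (mu : set R -> R -> R -> R) f (d : R) :
  C_b tau -> cutoff_family tau mu -> segal tau f -> 0 < d ->
  exists m : R -> R, [/\ cutoffs tau mu m, continuous (toC m),
    forall x, 0 <= m x <= 1 & forall x, modulus f x * (1 - m x) <= d].
Proof.
move=> [ctau _] hmu [f0 foo] d0.
pose K := [set x | d <= modulus f x].
have cK : compact K by exact: C_0_compact.
have [x Kx|e2 [e20 e21 Ke2]] := compact_sublevel tau K ctau cK.
  rewrite ltNge; apply/negP => /(segal_modulus0 _ _ _ foo) fx0.
  by move: Kx; rewrite /K /= fx0 leNgt d0.
(* The midpoint of [e2] and [1], so that [e2 < e1 < 1]. *)
pose e1 := (e2 + 1) / 2.
have adm : admissible tau e2 e1 K by split; rewrite ?midf_lt.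
have [[_ m01] _ [cm _] mK _] := hmu _ _ _ adm.
exists (mu K e1); split => //; first by exists e2, e1, K.
move=> x; have /andP[m0 m1] := m01 x.
have [/mK ->|/ltW fd] := leP d (modulus f x).
  by rewrite subrr mulr0 ltW.
apply: le_trans fd.
by rewrite ler_piMr ?modulus_ge0// gerBl.
Qed.

End Modulus.

Theorem lemma3p3 (R : realType) (tau : R -> R[i]^o) (htau : C_b tau)
    (mu : set R -> R -> R -> R) (hmu : cutoff_family tau mu)
    (f : R -> R[i]^o) (hf : segal tau f) :
  exists g : nat -> R -> R,
    (forall n, cutoffs tau mu (g n)) /\
    segal_cvg tau (fun n => f * toC (g n)) f.
Proof.
have d0 n : 0 < n.+1%:R^-1 :> R by rewrite invr_gt0.
have [g hg] := choice (fun n => segal_cutoff tau mu f _ htau hmu hf (d0 n)).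
exists g; split=> [n|]; first by case: (hg n).
have [[cf _ _] foo] := hf.
(* This makes the bound by [d] uniform in [k]: powers of [tau] can grow only where [|tau| > 1], and
   there [f] vanishes. *)
have tau_le1 x k : modulus f x * modulus tau x ^+ k <= modulus f x.
  have [t1|/ltW t1] := leP 1 (modulus tau x).
    by rewrite (segal_modulus0 _ _ _ foo t1) mul0r.
  by rewrite ler_piMr ?modulus_ge0// exprn_ile1 ?modulus_ge0.
split=> // [n|].
  have [_ cg g01 _] := hg n; apply: segal_dominated hf _ _.
    by move=> x; apply: cvgM; [exact: cf|exact: cg].
  move=> x; have /andP[g0 g1] := g01 x.
  by rewrite modulusMtoC// ler_piMr ?modulus_ge0.
(* The dominating series is the norm series of [f], and the uniform bound on the [n]-th family of
   terms is [1 / (n + 1)]. *)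
apply: (nneseries_dominated_cvg0 _ _ _ _ _ _ foo _ (cvg_harmonic (R := R))).
- by move=> n k; exact: sup_norm_ge0.
- move=> n k; apply: le_sup_normM => x; have [_ _ g01 _] := hg n.
  have /andP[g0 g1] := g01 x.
  by rewrite modulusMtoCB// ler_piMr ?modulus_ge0// gerBl.
- move=> n k; apply: sup_norm_le => x; have [_ _ g01 gd] := hg n.
  have /andP[g0 g1] := g01 x.
  (* Regrouping as [(|f| |tau|^k) (1 - g n)] lets [tau_le1] remove the power of [tau] before the
     cutoff estimate applies. *)
  rewrite lee_fin modulusM modulusX modulusMtoCB// mulrAC.
  by apply: le_trans (gd x); rewrite ler_wpM2r ?subr_ge0.
Qed.
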